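(* Let $(\mathcal{A}_n)_{n\in\mathbb N}$ be a sequence of unital Banach algebras such that $C_{\mathrm{DI}}(\mathcal{A}_n)\to+\infty$ as $n\to\infty$. Then $\mathrm{Asy}(\mathcal{A}_n)$ is Dedekind-finite.
   Context: Banach algebras are complex and have a contractive product $\|ab\|\le\|a\|\|b\|$; a unital Banach algebra has unit $1$ with $\|1\|=1$. For a sequence $(\mathcal A_n)$ of Banach algebras, $\ell^\infty(\mathcal A_n)$ is the Banach algebra of all bounded sequences $(a_n)$ with $a_n\in\mathcal A_n$, with pointwise operations and the supremum norm; $c_0(\mathcal A_n)$ is the closed two-sided ideal of sequences with $\lim_{n\to\infty}\|a_n\|=0$; and $\mathrm{Asy}(\mathcal A_n)=\ell^\infty(\mathcal A_n)/c_0(\mathcal A_n)$ with the quotient norm. Two idempotents $p,q$ in an algebra $\mathcal A$ are equivalent, $p\sim q$, if there are $a,b\in\mathcal A$ with $p=ab$ and $q=ba$. A unital algebra $\mathcal A$ is Dedekind-finite if every idempotent $p\in\mathcal A$ with $p\sim 1$ satisfies $p=1$; otherwise it is Dedekind-infinite. For a unital Banach algebra $\mathcal A$, $$C_{\mathrm{DI}}(\mathcal A)=\inf\{\|a\|\|b\| : a,b\in\mathcal A,\ ab=1,\ ba\neq 1\}\in[1,+\infty],$$ with $\inf\emptyset=+\infty$ (so $C_{\mathrm{DI}}(\mathcal A)=+\infty$ exactly when $\mathcal A$ is Dedekind-finite). *)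

(* Defs.v *)
From HB Require Import structures.
From mathcomp Require Import all_boot all_order all_algebra.
From mathcomp Require Import complex.
From mathcomp Require Import all_classical all_reals all_analysis.

Set Implicit Arguments.
Unset Strict Implicit.
Unset Printing Implicit Defensive.

Import Order.TTheory GRing.Theory Num.Theory.
Import numFieldNormedType.Exports.
Import ComplexField.Normc.

Local Open Scope classical_set_scope.
Local Open Scope complex_scope.
Local Open Scope ring_scope.
Local Open Scope quotient_scope.

Lemma normc_ge0 (R : realType) (l : R[i]) : 0 <= normc l.
Proof. by case: l => a b; exact: sqrtr_ge0. Qed.

(* A type cannot be both a normedModType and an algType (the hierarchy has no
   join of the two below numDomainType), so an algebra norm is a separate
   operation, taking its values in R; normed_space below recovers the
   library's normed module. *)
HB.mixin Record isUnitalNormedAlgebra (R : realType) A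
    & GRing.Algebra R[i] A := {
  bnorm : A -> R ;
  bnormD : forall a b : A, bnorm (a + b) <= bnorm a + bnorm b ;
  bnormZ : forall (l : R[i]) (a : A), bnorm (l *: a) = normc l * bnorm a ;
  bnorm0_eq0 : forall a : A, bnorm a = 0 -> a = 0 ;
  bnormM : forall a b : A, bnorm (a * b) <= bnorm a * bnorm b ;
  bnorm1 : bnorm 1 = 1
}.

#[short(type="unitalNormedAlgType")]
HB.structure Definition UnitalNormedAlgebra (R : realType) :=
  {A of GRing.Algebra R[i] A & isUnitalNormedAlgebra R A}.

Definition normed_space (R : realType) (A : unitalNormedAlgType R) : Type := A.

Section NormedSpace.
Variables (R : realType) (A : unitalNormedAlgType R).
Local Notation V := (normed_space A).

Lemma bnorm0 : bnorm (0 : A) = 0.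
Proof.
by rewrite -(scale0r (0 : A)) bnormZ /normc /= expr0n /= addr0 sqrtr0 mul0r.
Qed.

Lemma bnormN (a : A) : bnorm (- a) = bnorm a.
Proof.
by rewrite -scaleN1r bnormZ /normc /= oppr0 sqrrN expr1n expr0n addr0 sqrtr1 mul1r.
Qed.

Lemma bnorm_ge0 (a : A) : 0 <= bnorm a.
Proof.
have := bnormD a (- a); rewrite subrr bnorm0 bnormN -mulr2n.
by rewrite pmulrn_lge0.
Qed.

HB.instance Definition _ := GRing.Lmodule.copy V A.

Let normC (a : V) : R[i] := (bnorm (a : A))%:C.

Let normC_D (a b : V) : normC (a + b) <= normC a + normC b.
Proof. by rewrite /normC -rmorphD/= lecR bnormD. Qed.

Let normC_Z (l : R[i]) (a : V) : normC (l *: a) = `|l| * normC a.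
Proof. by rewrite /normC bnormZ rmorphM. Qed.

Let normC_0_eq0 (a : V) : normC a = 0 -> a = 0.
Proof. by move=> [/bnorm0_eq0]. Qed.

HB.instance Definition _ :=
  Lmodule_isNormed.Build R[i] V normC_D normC_Z normC_0_eq0.

End NormedSpace.

HB.mixin Record UnitalNormedAlgebra_isBanach (R : realType) A
    & UnitalNormedAlgebra R A := {
  banach_complete : forall F : set_system (normed_space A),
    ProperFilter F -> cauchy F -> cvg F
}.

#[short(type="unitalBanachAlgType")]
HB.structure Definition UnitalBanachAlgebra (R : realType) :=
  {A of UnitalNormedAlgebra R A & UnitalNormedAlgebra_isBanach R A}.

Section DedekindFinite.
Variable A : pzRingType.

Definition idem_equiv (p q : A) := exists a b : A, p = a * b /\ q = b * a.

Definition Dedekind_finite :=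
  forall p : A, p * p = p -> idem_equiv p 1 -> p = 1.

End DedekindFinite.

Definition C_DI (R : realType) (A : unitalNormedAlgType R) : \bar R :=
  ereal_inf [set x | exists a b : A,
    [/\ a * b = 1, b * a <> 1 & x = (bnorm a * bnorm b)%:E]].

Section Linf.
Variables (R : realType) (A : nat -> unitalBanachAlgType R).

Record linf : Type := Linf {
  linf_val :> forall n, A n ;
  linf_bounded : exists M : R, forall n, bnorm (linf_val n) <= M
}.

HB.instance Definition _ := gen_eqMixin linf.
HB.instance Definition _ := gen_choiceMixin linf.

Lemma linf_ext (a b : linf) : (forall n, a n = b n) -> a = b.
Proof.
case: a b => [a ba] [b bb] /= ab.
have {}ab : a = b by apply: functional_extensionality_dep.
by subst b; congr Linf; exact: Prop_irrelevance.
Qed.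

Let zero_bounded : exists M : R, forall n, bnorm (0 : A n) <= M.
Proof. by exists 0 => n; rewrite bnorm0. Qed.

Let one_bounded : exists M : R, forall n, bnorm (1 : A n) <= M.
Proof. by exists 1 => n; rewrite bnorm1. Qed.

Let opp_bounded (a : linf) : exists M : R, forall n, bnorm (- a n) <= M.
Proof. by have [M aM] := linf_bounded a; exists M => n; rewrite bnormN. Qed.

Let add_bounded (a b : linf) : exists M : R, forall n, bnorm (a n + b n) <= M.
Proof.
have [M aM] := linf_bounded a; have [N bN] := linf_bounded b.
by exists (M + N) => n; rewrite (le_trans (bnormD _ _)) ?lerD.
Qed.

Let mul_bounded (a b : linf) : exists M : R, forall n, bnorm (a n * b n) <= M.
Proof.
have [M aM] := linf_bounded a; have [N bN] := linf_bounded b.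
by exists (M * N) => n; rewrite (le_trans (bnormM _ _)) ?ler_pM ?bnorm_ge0.
Qed.

Let scale_bounded (l : R[i]) (a : linf) :
  exists M : R, forall n, bnorm (l *: a n) <= M.
Proof.
have [M aM] := linf_bounded a; exists (normc l * M) => n.
by rewrite bnormZ ler_wpM2l // normc_ge0.
Qed.

Definition linf_zero := Linf zero_bounded.
Definition linf_one := Linf one_bounded.
Definition linf_opp a := Linf (opp_bounded a).
Definition linf_add a b := Linf (add_bounded a b).
Definition linf_mul a b := Linf (mul_bounded a b).
Definition linf_scale l a := Linf (scale_bounded l a).

Let linf_addA : associative linf_add.
Proof. by move=> a b c; apply: linf_ext => n /=; rewrite addrA. Qed.
Let linf_addC : commutative linf_add.
Proof. by move=> a b; apply: linf_ext => n /=; rewrite addrC. Qed.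
Let linf_add0 : left_id linf_zero linf_add.
Proof. by move=> a; apply: linf_ext => n /=; rewrite add0r. Qed.
Let linf_addN : left_inverse linf_zero linf_opp linf_add.
Proof. by move=> a; apply: linf_ext => n /=; rewrite addNr. Qed.

HB.instance Definition _ :=
  GRing.isZmodule.Build linf linf_addA linf_addC linf_add0 linf_addN.

Let linf_mulA : associative linf_mul.
Proof. by move=> a b c; apply: linf_ext => n /=; rewrite mulrA. Qed.
Let linf_mul1 : left_id linf_one linf_mul.
Proof. by move=> a; apply: linf_ext => n /=; rewrite mul1r. Qed.
Let linf_mulr1 : right_id linf_one linf_mul.
Proof. by move=> a; apply: linf_ext => n /=; rewrite mulr1. Qed.
Let linf_mulDl : left_distributive linf_mul +%R.
Proof. by move=> a b c; apply: linf_ext => n /=; rewrite mulrDl. Qed.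
Let linf_mulDr : right_distributive linf_mul +%R.
Proof. by move=> a b c; apply: linf_ext => n /=; rewrite mulrDr. Qed.
Let linf_one_neq0 : linf_one != 0.
Proof.
apply/eqP => /(congr1 (fun a : linf => a 0%N)) /= /eqP.
by rewrite oner_eq0.
Qed.

HB.instance Definition _ := GRing.Zmodule_isNzRing.Build linf
  linf_mulA linf_mul1 linf_mulr1 linf_mulDl linf_mulDr linf_one_neq0.

Let linf_scaleA l m a : linf_scale l (linf_scale m a) = linf_scale (l * m) a.
Proof. by apply: linf_ext => n /=; rewrite scalerA. Qed.
Let linf_scale1 : left_id 1 linf_scale.
Proof. by move=> a; apply: linf_ext => n /=; rewrite scale1r. Qed.
Let linf_scaleDr : right_distributive linf_scale +%R.
Proof. by move=> l a b; apply: linf_ext => n /=; rewrite scalerDr. Qed.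
Let linf_scaleDl a : {morph linf_scale^~ a : l m / l + m}.
Proof. by move=> l m; apply: linf_ext => n /=; rewrite scalerDl. Qed.

HB.instance Definition _ := GRing.Zmodule_isLmodule.Build R[i] linf
  linf_scaleA linf_scale1 linf_scaleDr linf_scaleDl.

Let linf_scaleAl (l : R[i]) (a b : linf) : l *: (a * b) = (l *: a) * b.
Proof. by apply: linf_ext => n /=; rewrite -scalerAl. Qed.

HB.instance Definition _ :=
  GRing.Lmodule_isLalgebra.Build R[i] linf linf_scaleAl.

Let linf_scaleAr (l : R[i]) (a b : linf) : l *: (a * b) = a * (l *: b).
Proof. by apply: linf_ext => n /=; rewrite -scalerAr. Qed.

HB.instance Definition _ :=
  GRing.Lalgebra_isAlgebra.Build R[i] linf linf_scaleAr.

Definition linf_norm (a : linf) : R := sup [set bnorm (a n) | n in [set: nat]].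

Lemma linf_norm_ub (a : linf) n : bnorm (a n) <= linf_norm a.
Proof.
apply: ub_le_sup; last by exists n.
by have [M aM] := linf_bounded a; exists M => _ [m _ <-].
Qed.

Lemma linf_norm_le (a : linf) (M : R) :
  (forall n, bnorm (a n) <= M) -> linf_norm a <= M.
Proof.
move=> aM; apply: ge_sup; first by exists (bnorm (a 0%N)), 0%N.
by move=> _ [n _ <-].
Qed.

Let linf_normD (a b : linf) : linf_norm (a + b) <= linf_norm a + linf_norm b.
Proof.
apply: linf_norm_le => n; rewrite (le_trans (bnormD _ _)) //.
by rewrite lerD ?linf_norm_ub.
Qed.

Let linf_normZ (l : R[i]) (a : linf) :
  linf_norm (l *: a) = normc l * linf_norm a.
Proof.
apply/eqP; rewrite eq_le; apply/andP; split.
  apply: linf_norm_le => n.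
  by rewrite bnormZ ler_wpM2l ?normc_ge0 ?linf_norm_ub.
have [->|l0] := eqVneq l 0.
  rewrite normc0 mul0r (le_trans _ (linf_norm_ub _ 0%N)) //.
  exact: bnorm_ge0.
have nl0 : 0 < normc l.
  rewrite lt_neqAle normc_ge0 andbT eq_sym.
  by apply: contra_neq l0; exact: eq0_normc.
rewrite -ler_pdivlMl //; apply: linf_norm_le => n.
by rewrite ler_pdivlMl // -bnormZ (linf_norm_ub (l *: a)).
Qed.

Let linf_norm0_eq0 (a : linf) : linf_norm a = 0 -> a = 0.
Proof.
move=> a0; apply: linf_ext => n; apply: bnorm0_eq0; apply/eqP.
by rewrite eq_le bnorm_ge0 andbT -a0 linf_norm_ub.
Qed.

Let linf_normM (a b : linf) : linf_norm (a * b) <= linf_norm a * linf_norm b.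
Proof.
apply: linf_norm_le => n; rewrite (le_trans (bnormM _ _)) //.
by rewrite ler_pM ?bnorm_ge0 ?linf_norm_ub.
Qed.

Let linf_norm1 : linf_norm 1 = 1.
Proof.
apply/eqP; rewrite eq_le linf_norm_le /= => [|n]; last by rewrite bnorm1.
by rewrite -[leLHS](@bnorm1 R (A 0%N)) (linf_norm_ub 1).
Qed.

HB.instance Definition _ := isUnitalNormedAlgebra.Build R linf
  linf_normD linf_normZ linf_norm0_eq0 linf_normM linf_norm1.

Definition c0 : {pred linf} :=
  [pred a : linf | `[< bnorm (a n) @[n --> \oo] --> (0 : R) >]].

Lemma c0P (a : linf) :
  reflect (bnorm (a n) @[n --> \oo] --> (0 : R)) (a \in c0).
Proof. exact: asboolP. Qed.

Lemma c0_squeeze (a : linf) (u : nat -> R) :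
  (forall n, bnorm (a n) <= u n) -> u @ \oo --> (0 : R) -> a \in c0.
Proof.
move=> au u0; apply/c0P.
apply: (squeeze_cvgr _ (cvg_cst 0) u0).
by near=> n; rewrite bnorm_ge0 au.
Unshelve. all: by end_near.
Qed.

Let c0_zmod_closed : zmod_closed c0.
Proof.
split.
  by apply: (@c0_squeeze _ (cst 0)) => [n|]; [rewrite bnorm0|exact: cvg_cst].
move=> a b /c0P a0 /c0P b0.
apply: (@c0_squeeze _ (fun n => bnorm (a n) + bnorm (b n))) => [n|].
  by rewrite (le_trans (bnormD _ _)) // bnormN.
by rewrite -[0]addr0; exact: cvgD.
Qed.

HB.instance Definition _ := GRing.isZmodClosed.Build linf c0 c0_zmod_closed.

Lemma c0_mull (a b : linf) : b \in c0 -> a * b \in c0.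
Proof.
move=> /c0P b0; have [M aM] := linf_bounded a.
apply: (@c0_squeeze _ (fun n => M * bnorm (b n))) => [n|].
  by rewrite (le_trans (bnormM _ _)) // ler_wpM2r ?bnorm_ge0.
by rewrite -[0](mulr0 M); apply: cvgM => //; exact: cvg_cst.
Qed.

Lemma c0_mulr (a b : linf) : a \in c0 -> a * b \in c0.
Proof.
move=> /c0P a0; have [M bM] := linf_bounded b.
apply: (@c0_squeeze _ (fun n => bnorm (a n) * M)) => [n|].
  by rewrite (le_trans (bnormM _ _)) // ler_wpM2l ?bnorm_ge0.
by rewrite -[0](mul0r M); apply: cvgM => //; exact: cvg_cst.
Qed.

Lemma c0_scale (l : R[i]) (a : linf) : a \in c0 -> l *: a \in c0.
Proof. by rewrite -[a in l *: a]mul1r scalerAl; exact: c0_mull. Qed.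

Lemma c0_closed (a : linf) :
  (forall e : R, 0 < e -> exists2 b, b \in c0 & linf_norm (a - b) <= e) ->
  a \in c0.
Proof.
move=> H; apply/c0P; apply/cvgrPdist_lt => e e0.
have e2 : 0 < e / 2 by rewrite divr_gt0.
have [b /c0P /cvgrPdist_lt /(_ _ e2) b0 abe] := H _ e2.
near=> n; have : `|0 - bnorm (b n)| < e / 2 by near: n.
rewrite !sub0r !normrN !ger0_norm ?bnorm_ge0 // => bn.
rewrite -[a n](subrK (b n)) (le_lt_trans (bnormD _ _)) // [e in _ < e]splitr.
by rewrite ler_ltD // (le_trans _ abe) // (linf_norm_ub (a - b)).
Unshelve. all: by end_near.
Qed.

End Linf.

Arguments c0 {R} A _.

Section Asy.
Variables (R : realType) (A : nat -> unitalBanachAlgType R).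
Local Notation L := (linf A).

(* Only the additive group {ideal_quot _} comes from the library, whose quotient
   rings are restricted to commutative rings. *)
Definition Asy : Type := {ideal_quot (c0 A)}.
HB.instance Definition _ := GRing.Zmodule.on Asy.

Definition asy_pi (a : L) : Asy := \pi_({ideal_quot (c0 A)}) a.

Lemma asy_piP (u : Asy) : exists a, u = asy_pi a.
Proof. by exists (repr (u : {ideal_quot (c0 A)})); rewrite /asy_pi reprK. Qed.

Lemma asy_pi_eq (a b : L) : asy_pi a = asy_pi b <-> a - b \in c0 A.
Proof.
rewrite /asy_pi -Quotient.equivE.
by split=> [/eqP|?]; [|apply/eqP]; rewrite piE.
Qed.

Lemma asy_piD a b : asy_pi (a + b) = asy_pi a + asy_pi b.
Proof. by rewrite /asy_pi !piE. Qed.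

Lemma asy_piN a : asy_pi (- a) = - asy_pi a.
Proof. by rewrite /asy_pi !piE. Qed.

Lemma asy_pi0 : asy_pi 0 = 0.
Proof. by rewrite /asy_pi !piE. Qed.

Definition asy_one : Asy := asy_pi 1.
Definition asy_mul (u v : Asy) : Asy :=
  asy_pi (repr (u : {ideal_quot (c0 A)}) * repr (v : {ideal_quot (c0 A)})).
Definition asy_scale (l : R[i]) (u : Asy) : Asy :=
  asy_pi (l *: repr (u : {ideal_quot (c0 A)})).

Let repr_pi (a : L) : a - repr (asy_pi a : {ideal_quot (c0 A)}) \in c0 A.
Proof. by apply/asy_pi_eq; rewrite {2}/asy_pi reprK. Qed.

Let asy_mul_pi a b : asy_mul (asy_pi a) (asy_pi b) = asy_pi (a * b).
Proof.
apply/esym/asy_pi_eq; set a' := repr _; set b' := repr _.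
have -> : a * b - a' * b' = a * (b - b') + (a - a') * b'.
  by rewrite mulrBr mulrBl addrA subrK.
by apply: rpredD; [apply: c0_mull|apply: c0_mulr]; exact: repr_pi.
Qed.

Let asy_scale_pi l a : asy_scale l (asy_pi a) = asy_pi (l *: a).
Proof. by apply/esym/asy_pi_eq; rewrite -scalerBr; apply/c0_scale/repr_pi. Qed.

Let asy_mulA : associative (@asy_mul).
Proof.
move=> u v w; have [a ->] := asy_piP u; have [b ->] := asy_piP v.
by have [c ->] := asy_piP w; rewrite !asy_mul_pi mulrA.
Qed.
Let asy_mul1 : left_id asy_one asy_mul.
Proof. by move=> u; have [a ->] := asy_piP u; rewrite asy_mul_pi mul1r. Qed.
Let asy_mulr1 : right_id asy_one asy_mul.
Proof. by move=> u; have [a ->] := asy_piP u; rewrite asy_mul_pi mulr1. Qed.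
Let asy_mulDl : left_distributive asy_mul +%R.
Proof.
move=> u v w; have [a ->] := asy_piP u; have [b ->] := asy_piP v.
have [c ->] := asy_piP w.
by rewrite -asy_piD !asy_mul_pi mulrDl asy_piD.
Qed.
Let asy_mulDr : right_distributive asy_mul +%R.
Proof.
move=> u v w; have [a ->] := asy_piP u; have [b ->] := asy_piP v.
have [c ->] := asy_piP w.
by rewrite -asy_piD !asy_mul_pi mulrDr asy_piD.
Qed.

Let one_notin_c0 : (1 : L) \notin c0 A.
Proof.
apply/negP => /c0P; rewrite [X in X @ _](_ : _ = cst 1); last first.
  by apply/funext => n /=; rewrite bnorm1.
move=> /(cvg_unique (@norm_hausdorff _ _) (cvg_cst _))/eqP.
by rewrite oner_eq0.
Qed.

Let asy_one_neq0 : asy_one != 0.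
Proof.
apply/eqP; rewrite -asy_pi0 => /asy_pi_eq; rewrite subr0.
exact/negP/one_notin_c0.
Qed.

HB.instance Definition _ := GRing.Zmodule_isNzRing.Build Asy
  asy_mulA asy_mul1 asy_mulr1 asy_mulDl asy_mulDr asy_one_neq0.

Lemma asy_piM (a b : L) : asy_pi (a * b) = asy_pi a * asy_pi b.
Proof. by rewrite -asy_mul_pi. Qed.

Lemma asy_pi1 : asy_pi 1 = 1.
Proof. by []. Qed.

Let asy_scaleA l m u : asy_scale l (asy_scale m u) = asy_scale (l * m) u.
Proof. by have [a ->] := asy_piP u; rewrite !asy_scale_pi scalerA. Qed.
Let asy_scale1 : left_id 1 asy_scale.
Proof. by move=> u; have [a ->] := asy_piP u; rewrite asy_scale_pi scale1r. Qed.
Let asy_scaleDr : right_distributive asy_scale +%R.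
Proof.
move=> l u v; have [a ->] := asy_piP u; have [b ->] := asy_piP v.
by rewrite -asy_piD !asy_scale_pi scalerDr asy_piD.
Qed.
Let asy_scaleDl u : {morph asy_scale^~ u : l m / l + m}.
Proof.
by move=> l m; have [a ->] := asy_piP u; rewrite !asy_scale_pi scalerDl asy_piD.
Qed.

HB.instance Definition _ := GRing.Zmodule_isLmodule.Build R[i] Asy
  asy_scaleA asy_scale1 asy_scaleDr asy_scaleDl.

Lemma asy_piZ (l : R[i]) (a : L) : asy_pi (l *: a) = l *: asy_pi a.
Proof. by rewrite -asy_scale_pi. Qed.

Let asy_scaleAl (l : R[i]) (u v : Asy) : l *: (u * v) = (l *: u) * v.
Proof.
have [a ->] := asy_piP u; have [b ->] := asy_piP v.
by rewrite -!(asy_piM, asy_piZ) scalerAl.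
Qed.

HB.instance Definition _ :=
  GRing.Lmodule_isLalgebra.Build R[i] Asy asy_scaleAl.

Let asy_scaleAr (l : R[i]) (u v : Asy) : l *: (u * v) = u * (l *: v).
Proof.
have [a ->] := asy_piP u; have [b ->] := asy_piP v.
by rewrite -!(asy_piM, asy_piZ) scalerAr.
Qed.

HB.instance Definition _ :=
  GRing.Lalgebra_isAlgebra.Build R[i] Asy asy_scaleAr.

Definition asy_norm (u : Asy) : R :=
  inf [set bnorm a | a in [set a : L | asy_pi a = u]].

Lemma asy_norm_lb (a : L) : asy_norm (asy_pi a) <= bnorm a.
Proof.
apply: ge_inf; last by exists a.
by exists 0 => _ [b _ <-]; exact: bnorm_ge0.
Qed.

Lemma asy_norm_ge (u : Asy) (x : R) :
  (forall a, asy_pi a = u -> x <= bnorm a) -> x <= asy_norm u.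
Proof.
move=> xu; apply: lb_le_inf; last by move=> _ [a au <-]; exact: xu.
by have [a ua] := asy_piP u; exists (bnorm a), a.
Qed.

Lemma asy_norm_lt (u : Asy) (x : R) :
  asy_norm u < x -> exists2 a, u = asy_pi a & bnorm a < x.
Proof.
move=> ux; apply: contrapT => H; move: ux; apply/negP; rewrite -leNgt.
apply: asy_norm_ge => a au; rewrite leNgt; apply/negP => ax.
by apply: H; exists a.
Qed.

Let asy_norm_ge0 u : 0 <= asy_norm u.
Proof. by apply: asy_norm_ge => a _; exact: bnorm_ge0. Qed.

Let asy_normD (u v : Asy) : asy_norm (u + v) <= asy_norm u + asy_norm v.
Proof.
apply/ler_addgt0Pr => e e0; have e2 : 0 < e / 2 by rewrite divr_gt0.
have [a -> /ltW] := @asy_norm_lt u (asy_norm u + e / 2) ltac:(by rewrite ltrDl).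
have [b -> /ltW] := @asy_norm_lt v (asy_norm v + e / 2) ltac:(by rewrite ltrDl).
move=> bv au; rewrite -asy_piD (le_trans (asy_norm_lb _)) //.
rewrite (le_trans (bnormD _ _)) // (le_trans (lerD au bv)) //.
by rewrite addrACA -splitr.
Qed.

Let asy_norm0 : asy_norm 0 <= 0.
Proof. by rewrite -asy_pi0 (le_trans (asy_norm_lb _)) ?bnorm0. Qed.

Let asy_normM (u v : Asy) : asy_norm (u * v) <= asy_norm u * asy_norm v.
Proof.
have piM b : asy_norm (u * asy_pi b) <= asy_norm u * bnorm b.
  have [b0|b0] := eqVneq (bnorm b) 0.
    by rewrite (bnorm0_eq0 _ b0) asy_pi0 mulr0 bnorm0 mulr0.
  have {}b0 : 0 < bnorm b by rewrite lt_neqAle eq_sym b0 bnorm_ge0.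
  rewrite -ler_pdivrMr //; apply: asy_norm_ge => a <-.
  by rewrite ler_pdivrMr // -asy_piM (le_trans (asy_norm_lb _)) ?bnormM.
have [u0|u0] := eqVneq (asy_norm u) 0.
  by have [b ->] := asy_piP v; rewrite u0 mul0r (le_trans (piM b)) ?u0 ?mul0r.
have {}u0 : 0 < asy_norm u by rewrite lt_neqAle eq_sym u0 asy_norm_ge0.
rewrite -ler_pdivrMl //; apply: asy_norm_ge => b <-.
by rewrite ler_pdivrMl.
Qed.

Let asy_normZ (l : R[i]) (u : Asy) : asy_norm (l *: u) = normc l * asy_norm u.
Proof.
have [->|l0] := eqVneq l 0.
  rewrite scale0r normc0 mul0r; apply/eqP.
  by rewrite eq_le asy_norm0 asy_norm_ge0.
have nl0 : 0 < normc l.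
  rewrite lt_neqAle normc_ge0 andbT eq_sym.
  by apply: contra_neq l0; exact: eq0_normc.
apply/eqP; rewrite eq_le; apply/andP; split.
  rewrite -ler_pdivrMl //; apply: asy_norm_ge => a <-.
  by rewrite ler_pdivrMl // -bnormZ -asy_piZ asy_norm_lb.
apply: asy_norm_ge => c clu; rewrite -ler_pdivlMl // -normcV -bnormZ.
have -> : u = asy_pi (l^-1 *: c) by rewrite asy_piZ clu scalerA mulVf ?scale1r.
exact: asy_norm_lb.
Qed.

Let asy_norm0_eq0 (u : Asy) : asy_norm u = 0 -> u = 0.
Proof.
have [a ->] := asy_piP u => a0; rewrite -asy_pi0; apply/asy_pi_eq.
rewrite subr0; apply: c0_closed => e e0.
have [|c ac ce] := @asy_norm_lt (asy_pi a) e; first by rewrite a0.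
exists (a - c); first exact/asy_pi_eq.
by rewrite opprB addrC subrK ltW.
Qed.

Let asy_norm1 : asy_norm 1 = 1.
Proof.
apply/eqP; rewrite eq_le -{1}asy_pi1 -{1}(@bnorm1 R L) asy_norm_lb /=.
apply: asy_norm_ge => a /esym a1.
have /c0P /cvgrPdist_lt a1c0 : 1 - a \in c0 A by exact/asy_pi_eq.
apply/ler_addgt0Pr => e /a1c0 a1e.
near \oo => n; have : `|0 - bnorm ((1 - a : L) n)| < e by near: n.
rewrite sub0r normrN ger0_norm ?bnorm_ge0 // => /ltW a1n.
rewrite -(@bnorm1 R (A n)) -[1 in leLHS](subrK (a n)) addrC.
rewrite (le_trans (bnormD _ _)) // lerD //.
exact: (linf_norm_ub a).
Unshelve. all: by end_near.
Qed.

HB.instance Definition _ := isUnitalNormedAlgebra.Build R Asy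
  asy_normD asy_normZ asy_norm0_eq0 asy_normM asy_norm1.

End Asy.

(* Main.v *)
(** Neumann series: lift [u * v = 1] in [Asy A] to bounded sequences with
    [a_n b_n -> 1].  For large [n] the element [a_n b_n] has a right inverse [c_n] of
    norm at most 2, so [a_n (b_n c_n) = 1] with a uniform bound on the product
    of the norms; since [C_DI (A_n) -> +oo], eventually [b_n c_n a_n = 1].
    Hence [1 - b_n a_n = b_n (c_n - 1) a_n], and [c_n -> 1]. *)
Require Import Defs.
From mathcomp Require Import all_boot all_order all_algebra.
From mathcomp Require Import complex.
From mathcomp Require Import all_classical all_reals all_analysis.
From mathcomp Require Import lra.

Import Order.TTheory GRing.Theory Num.Theory.
Import numFieldNormedType.Exports.

Local Open Scope classical_set_scope.
Local Open Scope ring_scope.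

(** Brings the filter completeness of [normed_space A] down to sequences and real radii. Controlling
    the tail around the single term [s N] is enough: it is the centre that [cauchy_exP] asks for. *)
Lemma bnorm_cauchy_cvg (R : realType) (A : unitalBanachAlgType R)
    (s : nat -> A) :
  (forall e : R, 0 < e ->
     exists N, forall k, bnorm (s (N + k)%N - s N) < e) ->
  exists l : A, forall e : R, 0 < e -> \forall n \near \oo, bnorm (l - s n) < e.
Proof.
move=> sC; pose t : nat -> normed_space A := s.
have : cvg (t @ \oo).
  apply: banach_complete; apply: cauchy_exP => e.
  (* A positive element of [R[i]] has zero imaginary part, so its real part is the radius. *)
  case: e => e i; rewrite ltcE /= => /andP[/eqP -> /sC [N sN]].
  exists (s N); exists N => // n /= Nn.
  rewrite -ball_normE /ball_ /= distrC.
  by rewrite /Num.norm /= ltcR -(subnKC Nn); exact: sN.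
move=> /cvgrPdist_lt tl; exists (lim (t @ \oo)) => e e0.
have := tl e%:C%C; rewrite ltcR => /(_ e0); apply: filterS => n.
by rewrite /Num.norm /= ltcR.
Qed.

Lemma neumann_right_inverse (R : realType) (A : unitalBanachAlgType R) (x : A) :
  bnorm x <= 2^-1 -> exists c : A, (1 - x) * c = 1 /\ bnorm c <= 2.
Proof.
move=> x2; pose s k : A := iter k (fun y => 1 + x * y) 0.
have xM y : bnorm (x * y) <= 2^-1 * bnorm y.
  by rewrite (le_trans (bnormM _ _)) // ler_wpM2r ?bnorm_ge0.
have s_bound k : bnorm (s k) <= 2.
  elim: k => [|k IH]; first by rewrite bnorm0.
  have := bnormD 1 (x * s k); rewrite bnorm1 -/(s k.+1).
  by have := xM (s k); lra.
(* Each step of [N] applies the contraction to both terms; at [N = 0] the bound is [s_bound], since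
   [s 0 = 0]. *)
have s_dist N k : bnorm (s (N + k)%N - s N) <= 2 * 2^-1 ^+ N.
  elim: N => [|N IH]; first by rewrite add0n subr0 expr0 mulr1.
  have -> : s (N.+1 + k)%N - s N.+1 = x * (s (N + k)%N - s N).
    by rewrite /= mulrBr opprD addrACA subrr add0r.
  by rewrite exprS; have := xM (s (N + k)%N - s N); lra.
have [|c cs] := bnorm_cauchy_cvg _ _ s.
  move=> e e0; have e2 : 0 < e / 2 by rewrite divr_gt0.
  have : (fun n => (2^-1 : R) ^+ n) @ \oo --> (0 : R).
    by apply: cvg_expr; rewrite ger0_norm; lra.
  move=> /cvgrPdist_lt /(_ _ e2) [N _ /(_ N (leqnn N))] /=.
  rewrite sub0r normrN ger0_norm ?exprn_ge0 ?invr_ge0 // => Ne.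
  by exists N => k; rewrite (le_lt_trans (s_dist N k)) //; lra.
have cE : c = 1 + x * c.
  apply/eqP; rewrite -subr_eq0; apply/eqP/bnorm0_eq0/eqP.
  rewrite eq_le bnorm_ge0 andbT; apply/ler_addgt0Pr => e e0; rewrite add0r.
  have e2 : 0 < e / 2 by rewrite divr_gt0.
  have [N _ cN] := cs _ e2.
  (* Since [s N.+1 = 1 + x * s N], the defect splits into two errors, below [e / 2] and [e / 4]. *)
  have -> : c - (1 + x * c) = (c - s N.+1) - x * (c - s N).
    by rewrite /= mulrBr opprB !opprD !addrA addrNK.
  have := bnormD (c - s N.+1) (- (x * (c - s N))); rewrite bnormN.
  have := cN N (leqnn N); have := cN N.+1 (leqnSn N) => /=.
  have := xM (c - s N); have := bnorm_ge0 (c - s N); lra.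
exists c; split; first by rewrite mulrBl mul1r {1}cE addrK.
(* The fixed-point equation gives |c| <= 1 + |c|/2, hence |c| <= 2. *)
have := bnormD 1 (x * c); rewrite -cE bnorm1; have := xM c; lra.
Qed.

Lemma C_DI_gt_left_inverse (R : realType) (A : unitalNormedAlgType R)
    (a b : A) :
  a * b = 1 -> ((bnorm a * bnorm b)%:E < C_DI A)%E -> b * a = 1.
Proof.
move=> ab1; apply: contraPP => ba1; apply/negP; rewrite -leNgt.
by apply: ereal_inf_lbound; exists a, b.
Qed.

(** The estimate at a single index. It is linear in the defect of [a * b], so for uniformly bounded
    norms it forces the defect of [b * a] to 0. Both factors 2 bound the Neumann inverse [c] of
    [1 - x = a * b]. *)
Lemma bnorm_subr1_mulC (R : realType) (A : unitalBanachAlgType R) (a b : A) :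
  bnorm (1 - a * b) <= 2^-1 ->
  ((bnorm a * (bnorm b * 2))%:E < C_DI A)%E ->
  bnorm (1 - b * a) <= bnorm b * (2 * bnorm (1 - a * b)) * bnorm a.
Proof.
set x := 1 - a * b => x2 ltC.
have [c [xc c2]] := neumann_right_inverse _ _ _ x2.
have abc : a * (b * c) = 1 by rewrite -xc /x opprB addrC subrK mulrA.
have bca : b * c * a = 1.
  apply: (C_DI_gt_left_inverse _ _ _ _ abc); apply: le_lt_trans ltC.
  rewrite lee_fin ler_wpM2l ?bnorm_ge0 // (le_trans (bnormM _ _)) //.
  by rewrite ler_wpM2l ?bnorm_ge0.
have -> : 1 - b * a = b * (x * c) * a.
  (* This identity extracts the small factor [x] from [c - 1]. *)
  have -> : x * c = c - 1 by rewrite -xc [(1 - x) * c]mulrBl mul1r opprB addrC subrK.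
  by rewrite mulrBr mulrBl bca mulr1.
rewrite (le_trans (bnormM _ _)) // ler_wpM2r ?bnorm_ge0 //.
rewrite (le_trans (bnormM _ _)) // ler_wpM2l ?bnorm_ge0 //.
by rewrite (le_trans (bnormM _ _)) // mulrC ler_wpM2r ?bnorm_ge0.
Qed.

Theorem proposition3p4 (R : realType) (A : nat -> unitalBanachAlgType R)
    (hA : C_DI (A n) @[n --> \oo] --> +oo%E) :
  Dedekind_finite (Asy A).
Proof.
move=> p _ [v [u [-> /esym]]].
(* With [a] lifting [u] and [b] lifting [v], [p] is the class of [b * a], while [1 - a * b] lies in
   [c0 A]. *)
have [a ->] := asy_piP u; have [b ->] := asy_piP v.
rewrite -!asy_piM -!asy_pi1 => /esym/asy_pi_eq/c0P ab1.
apply/esym/asy_pi_eq/c0P.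
have [M aM] := linf_bounded a; have [N bN] := linf_bounded b.
have M0 : 0 <= M by apply: le_trans (aM 0%N); exact: bnorm_ge0.
have N0 : 0 <= N by apply: le_trans (bN 0%N); exact: bnorm_ge0.
pose d n := bnorm (1 - a n * b n).
apply: (@squeeze_cvgr _ _ _ _ (cst 0) (fun n => N * (2 * d n) * M)).
- have half0 : (0 : R) < 2^-1 by rewrite invr_gt0.
  move/cvgrPdist_lt: ab1 => /(_ _ half0) ab1.
  (* A threshold independent of [n] that dominates the norm product required by
     [bnorm_subr1_mulC]. *)
  move/cvgeyPgt: hA => /(_ (M * (N * 2))) hA.
  near=> n; rewrite bnorm_ge0 /=.
  have dn : d n <= 2^-1.
    apply: ltW; rewrite -[d n]ger0_norm ?bnorm_ge0 // -normrN -sub0r.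
    by near: n.
  have : ((bnorm (a n) * (bnorm (b n) * 2))%:E < C_DI (A n))%E.
    apply: (@le_lt_trans _ _ (M * (N * 2))%:E); last by near: n.
    by rewrite lee_fin ler_pM ?mulr_ge0 ?bnorm_ge0 // ler_wpM2r.
  move=> /(bnorm_subr1_mulC _ _ _ _ dn) /le_trans; apply.
  by rewrite ler_pM ?mulr_ge0 ?bnorm_ge0 // ler_wpM2r ?mulr_ge0 ?bnorm_ge0.
- exact: cvg_cst.
- rewrite -[0](mul0r M) -[X in X * M](mulr0 N) -[X in N * X](mulr0 2).
  by apply: cvgM; [do 2 (apply: cvgM; first exact: cvg_cst)|exact: cvg_cst].
Unshelve. all: by end_near.
Qed.
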